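(* $$\frac{8\sqrt2}{5}=\sum_{j=0}^{\infty}\left(-\frac14\right)^{j}\frac{\left(\frac58\right)_j\left(\frac34\right)_j\left(\frac98\right)_j}{(1)_j\left(\frac54\right)_j\left(\frac54\right)_j}\,(8j+3).$$
   Context: $(x)_0=1$ and $(x)_j=x(x+1)\cdots(x+j-1)$ for positive integers $j$ (rising factorial). *)

(* Defs.v *)
From Stdlib Require Import Reals.
From Coquelicot Require Import Coquelicot.
Open Scope R_scope.

(* Rising factorial (x)_j = x (x+1) ... (x+j-1), with (x)_0 = 1. *)
Fixpoint rising (x : R) (j : nat) : R :=
  match j with
  | O => 1
  | S k => rising x k * (x + INR k)
  end.

(* Main.v *)
Require Import Defs.
From Stdlib Require Import Reals.
From Coquelicot Require Import Coquelicot.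
From Stdlib Require Import Lra Lia.
Open Scope R_scope.

(** Embed the series in the one-parameter family
    T(a) = sum_n (-1)^n (a)_n (3/4)_n^2 (a+1/2)_{2n}
                 / (n! (a+3/4)_{2n+1}^2) * numer(a, n)      (a >= 3/4).
    At a = 3/4 the duplication formula turns (3/2)_{2n} into
    4^n (3/4)_n (5/4)_n, both factors (3/4)_n cancel, the cubic [numer]
    becomes (2n+3/2)^2 times a linear polynomial, and 16/5 times the summand is the given
    one ([term_three_quarters]).

    The family arises by accelerating the well-poised series
    sum_k (-1)^k (a+2k) (a)_k (1/4)_k^2 / (k! (a+3/4)_k^2), whose closed form
    is Gamma(a+3/4)^2 / (Gamma(a) Gamma(a+1/2)).  No Gamma function is needed
    below: the summands of T(a+1) and T(a), suitably normalised, differ by a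
    telescoping difference ([wz_pair]), so that
    T(a+1) * a(a+1/2)/(a+3/4)^2 = T(a)   ([total_shift]),
    and iterating from a = 3/4 gives T(3/4) = w_m T(3/4+m) with
    w_m = (3/4)_m (5/4)_m / (3/2)_m^2   ([total_weight]).

    Now let m tend to infinity.  The first summand of T(a) is a + O(1) and the
    remaining ones have a sum bounded uniformly in a, because the factor in
    front of [numer] drops by 1/a at the first step and by 1/4 at every later
    one, at least ([base_bound]); hence
    T(3/4+m) / (m+1) tends to 1 ([total_lim]).  On the other side, two
    duplications give w_m^2 = W_{2m} / (W_m (m+1)(2m+1)), where
    W_n = (3/2)_n^2 / (n!^2 (n+1)) is increasing and bounded.  Its limit (which
    is 4/pi) cancels, so w_m (m+1) tends to sqrt(1/2) ([weight_lim]).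
    Therefore T(3/4) = sqrt(1/2), and 16/5 * sqrt(1/2) = 8 sqrt(2) / 5. *)

(** * Rising factorials *)

Lemma rising_S (x : R) (n : nat) : rising x (S n) = rising x n * (x + INR n).
Proof. reflexivity. Qed.

Lemma rising_pos (x : R) (n : nat) : 0 < x -> 0 < rising x n.
Proof.
  intros Hx; induction n as [|n IH]; simpl rising; [lra|].
  apply Rmult_lt_0_compat; [exact IH|].
  pose proof (pos_INR n); lra.
Qed.

Lemma rising_shift (x : R) (n : nat) :
  x * rising (x + 1) n = rising x n * (x + INR n).
Proof.
  induction n as [|n IH]; [simpl; ring|].
  rewrite !rising_S, S_INR, <- Rmult_assoc, IH; ring.
Qed.

Lemma rising_double (x : R) (n : nat) :
  rising (2 * x) (2 * n) = 4 ^ n * (rising x n * rising (x + 1 / 2) n).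
Proof.
  induction n as [|n IH]; [simpl; ring|].
  replace (2 * S n)%nat with (S (S (2 * n))) by lia.
  rewrite !rising_S, IH, S_INR, mult_INR; simpl pow; change (INR 2) with 2; field.
Qed.

(** * The family of series and its WZ certificate *)

(** The hypergeometric part of the summand; the remaining part is a
    polynomial. *)
Definition base (a : R) (n : nat) : R :=
  (-1) ^ n * rising a n * rising (3 / 4) n ^ 2 * rising (a + 1 / 2) (2 * n)
  / (rising 1 n * rising (a + 3 / 4) (S (2 * n)) ^ 2).

(** The cubic that comes out of one acceleration step of the well-poised
    series in the header, with x in place of the summation index. *)
Definition numer (a x : R) : R :=
  a * (a + 1 / 2) * (a + 3 / 2) + x * (7 * a ^ 2 + 8 * a + 21 / 16)
  + x ^ 2 * (15 * a + 15 / 2) + 10 * x ^ 3.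

Definition term (a : R) (n : nat) : R := base a n * numer a (INR n).

(** The certificate of the WZ pair.  It vanishes at x = 0, so the telescoping
    sum has no lower boundary term. *)
Definition cert (a x : R) : R := x * (a + 3 / 4 + 2 * x) ^ 2.

(** Minus the quotient of consecutive values of [base]. *)
Definition ratio (a x : R) : R :=
  (a + x) * (3 / 4 + x) ^ 2 * (a + 1 / 2 + 2 * x) * (a + 3 / 2 + 2 * x)
  / ((1 + x) * (a + 7 / 4 + 2 * x) ^ 2 * (a + 11 / 4 + 2 * x) ^ 2).

Lemma base_S (a : R) (n : nat) :
  0 < a -> base a (S n) = - (base a n * ratio a (INR n)).
Proof.
  intros Ha; unfold base, ratio.
  replace (2 * S n)%nat with (S (S (2 * n))) by lia.
  pose proof (pos_INR n).
  pose proof (rising_pos 1 n ltac:(lra)).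
  pose proof (rising_pos (a + 3 / 4) (2 * n) ltac:(lra)).
  rewrite !rising_S, !S_INR, mult_INR; change (INR 2) with 2.
  simpl ((-1) ^ (S n)).
  set (x := INR n) in *.
  field; repeat split; nra.
Qed.

Lemma base_shift (a : R) (n : nat) :
  0 < a ->
  base (a + 1) n * (a * (a + 1 / 2) / (a + 3 / 4) ^ 2)
  = base a n * ((a + INR n) * (a + 1 / 2 + 2 * INR n)
                / (a + 7 / 4 + 2 * INR n) ^ 2).
Proof.
  intros Ha.
  pose proof (pos_INR n).
  pose proof (rising_pos 1 n ltac:(lra)).
  pose proof (rising_pos (a + 3 / 4) (S (2 * n)) ltac:(lra)).
  pose proof (rising_shift a n) as Hs1.
  pose proof (rising_shift (a + 1 / 2) (2 * n)) as Hs2.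
  pose proof (rising_shift (a + 3 / 4) (S (2 * n))) as Hs3.
  rewrite S_INR in Hs3; rewrite mult_INR in Hs2, Hs3; change (INR 2) with 2 in *.
  assert (E1 : rising (a + 1) n = rising a n * (a + INR n) / a)
    by (rewrite <- Hs1; field; lra).
  assert (E2 : rising (a + 1 + 1 / 2) (2 * n)
               = rising (a + 1 / 2) (2 * n) * (a + 1 / 2 + 2 * INR n)
                 / (a + 1 / 2)).
  { replace (a + 1 + 1 / 2) with (a + 1 / 2 + 1) by ring.
    rewrite <- Hs2; field; lra. }
  assert (E3 : rising (a + 1 + 3 / 4) (S (2 * n))
               = rising (a + 3 / 4) (S (2 * n)) * (a + 7 / 4 + 2 * INR n)
                 / (a + 3 / 4)).
  { replace (a + 1 + 3 / 4) with (a + 3 / 4 + 1) by ring.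
    replace (a + 7 / 4 + 2 * INR n) with (a + 3 / 4 + (2 * INR n + 1)) by field.
    rewrite <- Hs3; field; lra. }
  unfold base; rewrite E1, E2, E3.
  field; repeat split; lra.
Qed.

(** After division by [base a n] this is an identity between rational functions
    of [a] and [n]; the normalising factor is the quotient of the closed forms
    at a and a + 1. *)
Lemma wz_pair (a : R) (n : nat) :
  0 < a ->
  term (a + 1) n * (a * (a + 1 / 2) / (a + 3 / 4) ^ 2) - term a n
  = base a (S n) * cert a (INR (S n)) - base a n * cert a (INR n).
Proof.
  intros Ha.
  pose proof (pos_INR n).
  unfold term.
  replace (base (a + 1) n * numer (a + 1) (INR n)
           * (a * (a + 1 / 2) / (a + 3 / 4) ^ 2))
    with (base (a + 1) n * (a * (a + 1 / 2) / (a + 3 / 4) ^ 2)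
          * numer (a + 1) (INR n)) by ring.
  rewrite base_shift, base_S, S_INR by exact Ha.
  unfold ratio, cert, numer.
  field; repeat split; lra.
Qed.

(** * Bounds uniform in the parameter *)

(** Enlarge 3/4 + x to 1 + x and the last two factors of the numerator to
    a + 7/4 + 2x and a + 11/4 + 2x.  After cancellation (a + x)(1 + x) remains
    over the product of these two, which both exceed the sum
    (a + x) + (1 + x), so the arithmetic-geometric inequality gives the 1/4. *)
Lemma ratio_bounds (a x : R) : 0 < a -> 0 <= x -> 0 <= ratio a x <= 1 / 4.
Proof.
  intros Ha Hx; unfold ratio.
  set (p := a + 7 / 4 + 2 * x); set (q := a + 11 / 4 + 2 * x).
  assert (Hp : 0 < p) by (unfold p; lra).
  assert (Hq : 0 < q) by (unfold q; lra).
  assert (Hd : 0 < (1 + x) * p ^ 2 * q ^ 2)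
    by (repeat apply Rmult_lt_0_compat; try apply pow_lt; lra).
  split.
  - apply Rdiv_le_0_compat; [|exact Hd].
    repeat apply Rmult_le_pos; try apply pow_le; lra.
  - apply Rle_div_l; [exact Hd|].
    apply Rle_trans with ((a + x) * (1 + x) ^ 2 * p * q).
    + apply Rmult_le_compat; try (unfold p, q; lra).
      * repeat apply Rmult_le_pos; try apply pow_le; lra.
      * apply Rmult_le_compat; try (unfold p; lra).
        -- repeat apply Rmult_le_pos; try apply pow_le; lra.
        -- apply Rmult_le_compat_l; [lra|]. apply pow_incr; lra.
    + replace ((a + x) * (1 + x) ^ 2 * p * q)
        with (((1 + x) * p * q) * ((a + x) * (1 + x))) by ring.
      replace (1 / 4 * ((1 + x) * p ^ 2 * q ^ 2))
        with (((1 + x) * p * q) * (1 / 4 * (p * q))) by field.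
      apply Rmult_le_compat_l.
      * repeat apply Rmult_le_pos; lra.
      * pose proof (pow2_ge_0 (a - 1)). unfold p, q; nra.
Qed.

(** The first ratio is at most 1/a, and [base a 0] is of order 1/a^2: together
    they offset the cubic growth of [numer] in a and keep the tail bounded. *)
Lemma base_1_bound (a : R) : 0 < a -> Rabs (base a 1) <= 1 / (a * (a + 3 / 4) ^ 2).
Proof.
  intros Ha.
  rewrite base_S, Rabs_Ropp, Rabs_mult by exact Ha.
  assert (E : base a 0 = 1 / (a + 3 / 4) ^ 2)
    by (unfold base; simpl; field; lra).
  rewrite E.
  destruct (ratio_bounds a (INR 0) Ha (Rle_refl _)) as [Hr _].
  rewrite (Rabs_pos_eq (ratio _ _) Hr).
  rewrite Rabs_pos_eq
    by (apply Rdiv_le_0_compat; [lra| apply pow_lt; lra]).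
  replace (1 / (a * (a + 3 / 4) ^ 2)) with (1 / (a + 3 / 4) ^ 2 * (1 / a))
    by (field; lra).
  apply Rmult_le_compat_l.
  { apply Rdiv_le_0_compat; [lra| apply pow_lt; lra]. }
  unfold ratio; simpl (INR 0).
  apply Rle_div_l; [repeat apply Rmult_lt_0_compat; try apply pow_lt; lra|].
  apply Rmult_le_reg_l with a; [exact Ha|].
  replace (a * (1 / a * ((1 + 0) * (a + 7 / 4 + 2 * 0) ^ 2 * (a + 11 / 4 + 2 * 0) ^ 2)))
    with ((a + 7 / 4) ^ 2 * (a + 11 / 4) ^ 2) by (field; lra).
  assert (0 < a ^ 2) by (apply pow_lt; lra).
  assert (0 < a ^ 3) by (apply pow_lt; lra).
  assert (0 < a ^ 4) by (apply pow_lt; lra).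
  ring_simplify; lra.
Qed.

Lemma base_bound (a : R) (n : nat) :
  0 < a -> Rabs (base a (S n)) <= 1 / (a * (a + 3 / 4) ^ 2) * (1 / 4) ^ n.
Proof.
  intros Ha; induction n as [|n IH].
  - rewrite pow_O, Rmult_1_r; apply base_1_bound, Ha.
  - rewrite base_S, Rabs_Ropp, Rabs_mult by exact Ha.
    destruct (ratio_bounds a (INR (S n)) Ha (pos_INR _)) as [H0 H1].
    rewrite (Rabs_pos_eq _ H0).
    replace ((1 / 4) ^ S n) with ((1 / 4) ^ n * (1 / 4)) by (simpl; ring).
    rewrite <- Rmult_assoc.
    apply Rmult_le_compat; auto using Rabs_pos.
Qed.

Lemma cube_le_pow2 (n : nat) : (INR n + 1) ^ 3 <= 8 * 2 ^ n.
Proof.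
  destruct n as [|[|[|n]]]; try (simpl; lra).
  induction n as [|n IH]; [simpl; lra|].
  rewrite S_INR; rewrite S_INR in IH |- *; rewrite S_INR in IH |- *.
  rewrite S_INR in IH |- *.
  pose proof (pos_INR n).
  change (2 ^ S (S (S (S n)))) with (2 * 2 ^ S (S (S n))).
  set (x := INR n) in *; nra.
Qed.

(** Both inequalities hold coefficient by coefficient.  The lower one lets the
    boundary term of the telescoping sum be dominated by the summand itself. *)
Lemma numer_bounds (a x : R) :
  0 < a -> 0 <= x -> cert a x <= numer a x <= 10 * (a + x + 1) ^ 3.
Proof.
  intros Ha Hx.
  assert (0 <= a * x) by (apply Rmult_le_pos; lra).
  assert (0 <= a ^ 2) by apply pow2_ge_0.
  assert (0 <= x ^ 2) by apply pow2_ge_0.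
  assert (0 <= a ^ 3) by (apply pow_le; lra).
  assert (0 <= x ^ 3) by (apply pow_le; lra).
  assert (0 <= a ^ 2 * x) by (apply Rmult_le_pos; lra).
  assert (0 <= a * x ^ 2) by (apply Rmult_le_pos; lra).
  unfold cert, numer; split; ring_simplify; lra.
Qed.

(** Since a >= 3/4, a + n + 2 <= 4a (n + 1), so [numer] is at most
    10 * 64 * a^3 (n + 1)^3 <= 640 * 8 * a^3 2^n, and 640 * 8 = 5120. *)
Lemma term_bound (a : R) (n : nat) :
  3 / 4 <= a -> Rabs (term a (S n)) <= 5120 * (1 / 2) ^ n.
Proof.
  intros Ha.
  pose proof (pos_INR n) as Hn.
  unfold term; rewrite Rabs_mult.
  destruct (numer_bounds a (INR (S n)) ltac:(lra) (pos_INR _)) as [H0 H1].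
  assert (Hc : 0 <= cert a (INR (S n)))
    by (apply Rmult_le_pos; [apply pos_INR | apply pow2_ge_0]).
  rewrite (Rabs_pos_eq (numer _ _)) by lra.
  assert (Hd : 0 < a * (a + 3 / 4) ^ 2)
    by (apply Rmult_lt_0_compat; [|apply pow_lt]; lra).
  apply Rle_trans with
    (1 / (a * (a + 3 / 4) ^ 2) * (1 / 4) ^ n * (640 * a ^ 3 * (8 * 2 ^ n))).
  - apply Rmult_le_compat; [apply Rabs_pos | lra | apply base_bound; lra |].
    eapply Rle_trans; [exact H1|].
    apply Rle_trans with (640 * a ^ 3 * (INR n + 1) ^ 3).
    + replace (640 * a ^ 3 * (INR n + 1) ^ 3)
        with (10 * (4 * a * (INR n + 1)) ^ 3) by ring.
      apply Rmult_le_compat_l; [lra|].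
      rewrite S_INR; apply pow_incr; nra.
    + apply Rmult_le_compat_l, cube_le_pow2.
      apply Rmult_le_pos; [lra | apply pow_le; lra].
  - replace ((1 / 2) ^ n) with ((1 / 4) ^ n * 2 ^ n)
      by (rewrite <- Rpow_mult_distr; f_equal; lra).
    assert (0 < (1 / 4) ^ n * 2 ^ n)
      by (apply Rmult_lt_0_compat; apply pow_lt; lra).
    replace (1 / (a * (a + 3 / 4) ^ 2) * (1 / 4) ^ n * (640 * a ^ 3 * (8 * 2 ^ n)))
      with (5120 * (a ^ 3 / (a * (a + 3 / 4) ^ 2)) * ((1 / 4) ^ n * 2 ^ n))
      by (field; lra).
    apply Rmult_le_compat_r; [lra|].
    assert (a ^ 3 / (a * (a + 3 / 4) ^ 2) <= 1) by (apply Rle_div_l; nra).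
    lra.
Qed.

Lemma is_series_half (K : R) : is_series (fun n => K * (1 / 2) ^ n) (2 * K).
Proof.
  replace (2 * K) with (scal K (/ (1 - 1 / 2)))
    by (unfold scal; simpl; unfold mult; simpl; field).
  apply (is_series_scal_l (V := R_NormedModule)).
  apply is_series_geom; rewrite Rabs_pos_eq; lra.
Qed.

Lemma ex_series_tail (a : R) : 3 / 4 <= a -> ex_series (fun n => Rabs (term a (S n))).
Proof.
  intros Ha.
  apply (ex_series_le (V := R_CompleteNormedModule)
           (fun n => Rabs (term a (S n))) (fun n => 5120 * (1 / 2) ^ n)).
  - intros n; change (Rabs (Rabs (term a (S n))) <= 5120 * (1 / 2) ^ n).
    rewrite Rabs_Rabsolu; apply term_bound, Ha.
  - eexists; apply is_series_half.
Qed.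

Lemma ex_series_term (a : R) : 3 / 4 <= a -> ex_series (term a).
Proof.
  intros Ha; apply (ex_series_incr_1 (V := R_NormedModule)).
  apply ex_series_Rabs, ex_series_tail, Ha.
Qed.

(** * The sum as a function of the parameter *)

Definition total (a : R) : R := Series (term a).

(** The first summand contributes a up to an error in [0, 1], the others at most
    2 * 5120. *)
Lemma total_approx (a : R) : 3 / 4 <= a -> Rabs (total a - a) <= 10241.
Proof.
  intros Ha; unfold total.
  rewrite Series_incr_1 by (apply ex_series_term, Ha).
  assert (Htail : Rabs (Series (fun n => term a (S n))) <= 2 * 5120).
  { eapply Rle_trans; [apply Series_Rabs, ex_series_tail, Ha|].
    rewrite <- (is_series_unique _ _ (is_series_half 5120)).
    apply Series_le; [|eexists; apply is_series_half].
    intros n; split; [apply Rabs_pos | apply term_bound, Ha]. }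
  assert (H0 : 0 <= term a 0 - a <= 1).
  { replace (term a 0 - a)
      with (a * (a / 2 + 3 / 16) / (a + 3 / 4) ^ 2)
      by (unfold term, base, numer; simpl; field; lra).
    split.
    - apply Rdiv_le_0_compat; [nra | apply pow_lt; lra].
    - apply Rle_div_l; [apply pow_lt; lra | nra]. }
  apply Rabs_le_between in Htail; apply Rabs_le_between; lra.
Qed.

Lemma total_shift (a : R) :
  3 / 4 <= a -> total (a + 1) * (a * (a + 1 / 2) / (a + 3 / 4) ^ 2) = total a.
Proof.
  intros Ha.
  set (c := a * (a + 1 / 2) / (a + 3 / 4) ^ 2).
  assert (Hlim : is_lim_seq (fun n => base a n * cert a (INR n)) 0).
  { apply is_lim_seq_abs_0.
    apply is_lim_seq_le_le with (fun _ => 0) (fun n => Rabs (term a n)).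
    - intros n; split; [apply Rabs_pos|].
      unfold term; rewrite !Rabs_mult.
      apply Rmult_le_compat_l; [apply Rabs_pos|].
      destruct (numer_bounds a (INR n) ltac:(lra) (pos_INR _)) as [H _].
      assert (0 <= cert a (INR n))
        by (apply Rmult_le_pos; [apply pos_INR | apply pow2_ge_0]).
      rewrite !Rabs_pos_eq; lra.
    - apply is_lim_seq_const.
    - rewrite <- Rabs_R0.
      apply (is_lim_seq_abs (term a) 0), ex_series_lim_0, ex_series_term, Ha. }
  assert (Htel : is_series (fun n => term (a + 1) n * c - term a n) 0).
  { unfold is_series.
    assert (E : forall n, @eq R (sum_n (fun n => term (a + 1) n * c - term a n) n)
                            (base a (S n) * cert a (INR (S n)))).
    { induction n as [|n IH].
      - rewrite sum_O; etransitivity; [exact (wz_pair a 0 ltac:(lra))|].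
        unfold cert at 2; simpl (INR 0); ring.
      - rewrite sum_Sn, IH; unfold c; rewrite wz_pair by lra.
        unfold plus; simpl; ring. }
    apply (is_lim_seq_ext (fun n => base a (S n) * cert a (INR (S n))) _ 0).
    - intros n; symmetry; apply E.
    - apply (is_lim_seq_incr_1 (fun n => base a n * cert a (INR n))), Hlim. }
  apply is_series_unique in Htel.
  rewrite Series_minus in Htel.
  - rewrite Series_scal_r in Htel; unfold total; lra.
  - apply ex_series_scal_r, ex_series_term; lra.
  - apply ex_series_term, Ha.
Qed.

(** The product of the normalising factors at 3/4, 3/4 + 1, ..., 3/4 + m - 1. *)
Definition weight (m : nat) : R :=
  rising (3 / 4) m * rising (5 / 4) m / rising (3 / 2) m ^ 2.

Lemma total_weight (m : nat) : total (3 / 4) = weight m * total (3 / 4 + INR m).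
Proof.
  induction m as [|m IH].
  - unfold weight; simpl; rewrite Rplus_0_r; field.
  - rewrite IH, <- total_shift by (pose proof (pos_INR m); lra).
    rewrite S_INR, Rplus_assoc; unfold weight; rewrite !rising_S.
    pose proof (pos_INR m); pose proof (rising_pos (3 / 2) m ltac:(lra)).
    field; repeat split; lra.
Qed.

(** * Asymptotics *)

(** The Wallis-type quotient; the factor n + 1 is chosen so that it increases. *)
Definition wallis (n : nat) : R :=
  rising (3 / 2) n ^ 2 / (rising 1 n ^ 2 * (INR n + 1)).

(** The sequence increases, while its product with (n + 1) / n decreases from
    n = 1 on; the value 9/4 of that product at n = 1 is the upper bound. *)
Lemma wallis_lim : exists l : R, 0 < l /\ is_lim_seq wallis l.
Proof.
  assert (Hpos : forall n, 0 < wallis n).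
  { intros n; pose proof (pos_INR n).
    apply Rdiv_lt_0_compat; [apply pow_lt, rising_pos; lra|].
    apply Rmult_lt_0_compat; [apply pow_lt, rising_pos|]; lra. }
  assert (HS : forall n, wallis (S n)
            = wallis n * ((3 / 2 + INR n) ^ 2 / ((1 + INR n) * (INR n + 2)))).
  { intros n; unfold wallis; rewrite !rising_S, S_INR.
    pose proof (pos_INR n); pose proof (rising_pos 1 n ltac:(lra)).
    field; repeat split; lra. }
  assert (Hincr : forall n, wallis n <= wallis (S n)).
  { intros n; rewrite HS; pose proof (Hpos n); pose proof (pos_INR n).
    rewrite <- (Rmult_1_r (wallis n)) at 1.
    apply Rmult_le_compat_l; [lra|].
    apply Rle_div_r; nra. }
  assert (Hbd : forall n, wallis (S n) * ((INR n + 2) / (INR n + 1)) <= 9 / 4).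
  { induction n as [|n IH]; [unfold wallis; simpl; lra|].
    eapply Rle_trans; [|exact IH].
    rewrite (HS (S n)), S_INR, Rmult_assoc.
    pose proof (Hpos (S n)); pose proof (pos_INR n).
    apply Rmult_le_compat_l; [lra|].
    set (x := INR n) in *.
    apply Rminus_le_0.
    replace ((x + 2) / (x + 1) - (3 / 2 + (x + 1)) ^ 2
             / ((1 + (x + 1)) * (x + 1 + 2)) * ((x + 1 + 2) / (x + 1 + 1)))
      with ((3 / 4 * x + 7 / 4) / ((x + 1) * (x + 2) ^ 2)) by (field; lra).
    apply Rdiv_le_0_compat; [lra|].
    apply Rmult_lt_0_compat; [|apply pow_lt]; lra. }
  destruct (ex_finite_lim_seq_incr wallis (9 / 4) Hincr) as [l Hl].
  { intros n; eapply Rle_trans; [apply Hincr|].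
    eapply Rle_trans; [|apply (Hbd n)].
    pose proof (Hpos (S n)); pose proof (pos_INR n).
    rewrite <- (Rmult_1_r (wallis (S n))) at 1.
    apply Rmult_le_compat_l; [lra|].
    apply Rle_div_r; lra. }
  exists l; split; [|exact Hl].
  apply Rlt_le_trans with (wallis 0); [apply Hpos|].
  apply (is_lim_seq_incr_compare _ _ Hl Hincr).
Qed.

(** Duplication at 3/4 rewrites [weight m] through (3/2)_{2m}, and duplication
    at 1/2 rewrites the (2m)! in [wallis (2 * m)] through m! and (3/2)_m. *)
Lemma weight_sqr (m : nat) :
  weight m ^ 2
  = wallis (2 * m) / (wallis m * ((INR m + 1) * (2 * INR m + 1))).
Proof.
  pose proof (pos_INR m).
  pose proof (rising_pos 1 m ltac:(lra)).
  pose proof (rising_pos (3 / 2) m ltac:(lra)).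
  pose proof (rising_pos (1 / 2) m ltac:(lra)).
  pose proof (pow_lt 4 m ltac:(lra)).
  pose proof (rising_double (3 / 4) m) as Hd3.
  pose proof (rising_double (1 / 2) m) as Hd1.
  pose proof (rising_shift (1 / 2) m) as Hs.
  replace (2 * (3 / 4)) with (3 / 2) in Hd3 by field.
  replace (3 / 4 + 1 / 2) with (5 / 4) in Hd3 by field.
  replace (2 * (1 / 2)) with 1 in Hd1 by field.
  replace (1 / 2 + 1 / 2) with 1 in Hd1 by field.
  replace (1 / 2 + 1) with (3 / 2) in Hs by field.
  assert (E : rising (3 / 2) m = rising (1 / 2) m * (2 * INR m + 1)) by lra.
  unfold weight, wallis.
  rewrite mult_INR, Hd3, Hd1, E; change (INR 2) with 2.
  field; repeat split; lra.
Qed.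

Lemma is_lim_seq_INR_ratio (p q r : R) :
  0 < q -> 0 < r -> is_lim_seq (fun m => (INR m + p) / (q * INR m + r)) (/ q).
Proof.
  intros Hq Hr.
  apply is_lim_seq_ext with (fun m => / q + (p - r / q) / (q * INR m + r)).
  { intros m; pose proof (pos_INR m).
    field; split; [|lra]. nra. }
  replace (Finite (/ q)) with (Rbar_plus (/ q) 0) by (simpl; f_equal; ring).
  apply (is_lim_seq_plus _ _ (/ q) 0 (/ q + 0)); [apply is_lim_seq_const| |reflexivity].
  replace (Finite 0) with (Rbar_mult (p - r / q) 0) by (simpl; f_equal; ring).
  apply (is_lim_seq_scal_l (fun m => / (q * INR m + r)) (p - r / q) 0).
  replace (Finite 0) with (Rbar_inv p_infty) by reflexivity.
  apply is_lim_seq_inv; [|discriminate].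
  apply is_lim_seq_plus with p_infty r; [|apply is_lim_seq_const|reflexivity].
  replace p_infty with (Rbar_mult q p_infty).
  - apply is_lim_seq_scal_l, is_lim_seq_INR.
  - apply is_Rbar_mult_unique. simpl.
    apply is_Rbar_mult_sym, is_Rbar_mult_p_infty_pos; exact Hq.
Qed.

Lemma weight_lim : is_lim_seq (fun m => weight m * (INR m + 1)) (sqrt (1 / 2)).
Proof.
  destruct wallis_lim as [l [Hl Hlim]].
  assert (H2 : is_lim_seq (fun m => wallis (2 * m)) l).
  { apply (is_lim_seq_subseq wallis l (fun m => (2 * m)%nat)); [|exact Hlim].
    apply eventually_subseq; intros n; lia. }
  assert (Hq : is_lim_seq
            (fun m => wallis (2 * m) / wallis m * ((INR m + 1) / (2 * INR m + 1)))
            (1 / 2)).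
  { replace (1 / 2) with (l / l * / 2) by (field; lra).
    apply is_lim_seq_mult'; [|apply is_lim_seq_INR_ratio; lra].
    apply is_lim_seq_div'; [exact H2 | exact Hlim | lra]. }
  apply is_lim_seq_ext with
    (fun m => sqrt (wallis (2 * m) / wallis m * ((INR m + 1) / (2 * INR m + 1)))).
  - intros m; pose proof (pos_INR m).
    assert (Hw : 0 < wallis m).
    { apply Rdiv_lt_0_compat; [apply pow_lt, rising_pos; lra|].
      apply Rmult_lt_0_compat; [apply pow_lt, rising_pos|]; lra. }
    rewrite <- (sqrt_pow2 (weight m * (INR m + 1))).
    + f_equal; rewrite Rpow_mult_distr, weight_sqr; field; lra.
    + apply Rmult_le_pos; [|lra]; apply Rdiv_le_0_compat.
      * apply Rmult_le_pos; apply Rlt_le, rising_pos; lra.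
      * apply pow_lt, rising_pos; lra.
  - apply (is_lim_seq_continuous sqrt); [|exact Hq].
    apply continuity_pt_sqrt; lra.
Qed.

(** * Evaluation *)

Lemma total_lim : is_lim_seq (fun m => total (3 / 4 + INR m) / (INR m + 1)) 1.
Proof.
  apply is_lim_seq_le_le with
    (fun m => (INR m + -10242) / (1 * INR m + 1))
    (fun m => (INR m + 10242) / (1 * INR m + 1)).
  - intros m; pose proof (pos_INR m).
    pose proof (total_approx (3 / 4 + INR m) ltac:(lra)) as H1.
    apply Rabs_le_between in H1.
    rewrite Rmult_1_l; split; apply Rmult_le_compat_r; try lra;
      apply Rlt_le, Rinv_0_lt_compat; lra.
  - replace (Finite 1) with (Finite (/ 1)) by (f_equal; apply Rinv_1).
    apply is_lim_seq_INR_ratio; lra.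
  - replace (Finite 1) with (Finite (/ 1)) by (f_equal; apply Rinv_1).
    apply is_lim_seq_INR_ratio; lra.
Qed.

Lemma total_value : total (3 / 4) = sqrt (1 / 2).
Proof.
  assert (H : is_lim_seq (fun _ : nat => total (3 / 4)) (sqrt (1 / 2) * 1)).
  { apply is_lim_seq_ext with
      (fun m => weight m * (INR m + 1) * (total (3 / 4 + INR m) / (INR m + 1))).
    - intros m; pose proof (pos_INR m).
      rewrite (total_weight m); field; lra.
    - apply is_lim_seq_mult'; [apply weight_lim | apply total_lim]. }
  apply is_lim_seq_unique in H; rewrite Lim_seq_const in H.
  injection H; lra.
Qed.

(** Duplication at 3/4 and at 5/8, together with
    numer (3/4) x = (5/16) (8x + 3) (2x + 3/2)^2. *)
Lemma term_three_quarters (n : nat) :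
  (- (1 / 4)) ^ n
  * (rising (5 / 8) n * rising (3 / 4) n * rising (9 / 8) n
     / (rising 1 n * rising (5 / 4) n * rising (5 / 4) n))
  * (8 * INR n + 3)
  = 16 / 5 * term (3 / 4) n.
Proof.
  pose proof (pos_INR n).
  pose proof (rising_pos 1 n ltac:(lra)).
  pose proof (rising_pos (3 / 4) n ltac:(lra)).
  pose proof (rising_pos (5 / 4) n ltac:(lra)).
  pose proof (pow_lt 4 n ltac:(lra)).
  pose proof (rising_double (3 / 4) n) as Hd3.
  pose proof (rising_double (5 / 8) n) as Hd5.
  replace (2 * (3 / 4)) with (3 / 2) in Hd3 by field.
  replace (3 / 4 + 1 / 2) with (5 / 4) in Hd3 by field.
  replace (2 * (5 / 8)) with (5 / 4) in Hd5 by field.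
  replace (5 / 8 + 1 / 2) with (9 / 8) in Hd5 by field.
  unfold term, base, numer.
  replace (3 / 4 + 1 / 2) with (5 / 4) by field.
  replace (3 / 4 + 3 / 4) with (3 / 2) by field.
  rewrite rising_S, Hd3, Hd5, mult_INR; change (INR 2) with 2.
  replace ((- (1 / 4)) ^ n) with ((-1) ^ n / 4 ^ n).
  2:{ unfold Rdiv at 1; rewrite <- pow_inv, <- Rpow_mult_distr; f_equal; lra. }
  field; repeat split; lra.
Qed.

Theorem mainTheorem8 :
  is_series
    (fun j : nat =>
       (- (1 / 4)) ^ j
       * (rising (5 / 8) j * rising (3 / 4) j * rising (9 / 8) j
          / (rising 1 j * rising (5 / 4) j * rising (5 / 4) j))
       * (8 * INR j + 3))
    (8 * sqrt 2 / 5).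
Proof.
  apply is_series_ext with (fun n => 16 / 5 * term (3 / 4) n).
  { intros n; symmetry; apply term_three_quarters. }
  replace (8 * sqrt 2 / 5) with (16 / 5 * total (3 / 4)).
  - apply (is_series_scal_l (V := R_NormedModule)), Series_correct, ex_series_term.
    lra.
  - rewrite total_value, sqrt_div_alt, sqrt_1 by lra.
    assert (0 < sqrt 2) by (apply sqrt_lt_R0; lra).
    pose proof (sqrt_sqrt 2 ltac:(lra)).
    field_simplify_eq; lra.
Qed.
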